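(* Let $c_0=\tfrac14$, $c_1=\sqrt{1-c_0^2}$, and consider the qubit–qutrit state $|\psi\rangle=c_0|0\rangle_A|0\rangle_B+c_1|1\rangle_A|1\rangle_B$ in $\mathbb C^2\otimes\mathbb C^3$. Alice's measurements are the $\pm1$-valued observables $A_1=\sigma_z$ (with $A_1=+1$ on $|0\rangle$) and $A_2=\sigma_x$, with local contexts $\{A_1\}$ and $\{A_2\}$. Bob's measurements are the $\pm1$-valued observables $B_j=I-2|v_j\rangle\langle v_j|$, $j\in\mathbb Z/5$, where $$|v_j\rangle=\cos\theta|0\rangle+\sin\theta\cos\tfrac{4\pi j}{5}|1\rangle+\sin\theta\sin\tfrac{4\pi j}{5}|2\rangle,\qquad \cos\theta,\sin\theta>0,\quad \cos^2\theta=\tfrac1{\sqrt5},$$ with local contexts $\{B_j,B_{j+1}\}$, $j\in\mathbb Z/5$ (adjacent projectors are orthogonal, so these observables commute). The tested family $\mathcal C$ consists of all ten pairs of an Alice context and a Bob context. Then the quantum empirical model on $\mathcal C$ satisfies NCHV-local (both parties are locally noncontextual) and admits a GLHV decomposition, but admits no GNCHV model. That is, the experiment is globally contextual.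
   Context: Definitions (for parties $i=1,\dots,n$; here $n=2$). Party $i$ has a set $\mathcal M_i$ of measurements and a family $\mathcal C_i$ of local contexts; a local context $C_i\in\mathcal C_i$ is a set of compatible (jointly measurable, here commuting) measurements of party $i$, and $m_{ij}$ denotes the outcome of $j\in C_i$. A multipartite context is $C=(C_1,\dots,C_n)$, and the tested family is $\mathcal C\subseteq\mathcal C_1\times\cdots\times\mathcal C_n$. The empirical model assigns to each $C\in\mathcal C$ the joint outcome distribution $p_C$ (given by the Born rule for the joint measurement), and $p_{C_i}$ is the corresponding distribution for party $i$ alone (from the reduced state). NCHV-local: party $i$ is locally noncontextual if there are a hidden variable $\lambda_i$ with a single probability distribution $q_i$ and response probability distributions $p_i(\cdot|j,\lambda_i)$, one for each measurement $j$ and not depending on the context, such that $p_{C_i}(\{m_{ij}\}_{j\in C_i})=\sum_{\lambda_i}q_i(\lambda_i)\prod_{j\in C_i}p_i(m_{ij}|j,\lambda_i)$ for every $C_i\in\mathcal C_i$. NCHV-local holds if every party satisfies this. GLHV: there are one hidden variable $\lambda$, one probability distribution $q(\lambda)$ common to all tested contexts, and block response distributions $p_i(\cdot|C_i,\lambda)$ (arbitrary joint distributions of the outcomes of the measurements in $C_i$) such that $p_C(\{\{m_{ij}\}_{j\in C_i}\}_{i})=\sum_\lambda q(\lambda)\prod_{i=1}^n p_i(\{m_{ij}\}_{j\in C_i}|C_i,\lambda)$ for every $C\in\mathcal C$. GNCHV: there are one hidden variable $\xi$, one probability distribution $q(\xi)$, and context-independent response distributions $p(\cdot|j,\xi)$,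 one for each measurement $j\in\bigcup_i\mathcal M_i$, such that $p_C(\{\{m_{ij}\}_{j\in C_i}\}_i)=\sum_\xi q(\xi)\prod_{i=1}^n\prod_{j\in C_i}p(m_{ij}|j,\xi)$ for every $C\in\mathcal C$. The experiment is globally contextual if NCHV-local and GLHV hold but no GNCHV model exists. *)

(* Defs.v *)
From HB Require Import structures.
From mathcomp Require Import all_boot all_order all_algebra.
From mathcomp Require Import complex mxtens.
From mathcomp Require Import all_classical all_reals all_analysis.

Set Implicit Arguments.
Unset Strict Implicit.
Unset Printing Implicit Defensive.

Import Order.TTheory GRing.Theory Num.Theory.
Local Open Scope ring_scope.
Local Open Scope complex_scope.

(* Hidden variables range over an arbitrary set L and the sums over them are
   unconditional sums of nonnegative reals, so that finite and countably
   infinite hidden variables are both covered. *)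
Definition is_pmf (R : realType) (L : choiceType) (q : L -> R) : Prop :=
  (forall l, 0 <= q l) /\ (\esum_(l in [set: L]%classic) (q l)%:E = 1)%E.

Section HiddenVariables.
Variables (R : realType) (O : finType).

Definition outcomes (M : finType) (C : {set M}) : finType :=
  {ffun {j : M | j \in C} -> O}.

Definition locally_noncontextual (M : finType) (ctx : {set {set M}})
    (p : forall C : {set M}, outcomes C -> R) : Prop :=
  exists (L : choiceType) (q : L -> R) (r : M -> L -> O -> R),
  [/\ is_pmf q,
      forall j l, is_pmf (r j l) &
      forall C, C \in ctx -> forall m : outcomes C,
        ((p C m)%:E =
         \esum_(l in [set: L]%classic)
           (q l * \prod_(j : {j : M | j \in C}) r (val j) l (m j))%:E)%E].

Section TwoParties.
Variables (MA MB : finType).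
Variables (ctxA : {set {set MA}}) (ctxB : {set {set MB}}).
Variable tested : {set {set MA} * {set MB}}.
Variable pA : forall CA : {set MA}, outcomes CA -> R.
Variable pB : forall CB : {set MB}, outcomes CB -> R.
Variable p :
  forall (CA : {set MA}) (CB : {set MB}), outcomes CA -> outcomes CB -> R.

Definition NCHV_local : Prop :=
  locally_noncontextual ctxA pA /\ locally_noncontextual ctxB pB.

Definition GLHV : Prop :=
  exists (L : choiceType) (q : L -> R)
    (rA : forall CA : {set MA}, L -> outcomes CA -> R)
    (rB : forall CB : {set MB}, L -> outcomes CB -> R),
  [/\ is_pmf q,
      forall CA, CA \in ctxA -> forall l, is_pmf (rA CA l),
      forall CB, CB \in ctxB -> forall l, is_pmf (rB CB l) &
      forall CA CB, (CA, CB) \in tested ->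
      forall (a : outcomes CA) (b : outcomes CB),
        ((p a b)%:E =
         \esum_(l in [set: L]%classic) (q l * (rA CA l a * rB CB l b))%:E)%E].

Definition GNCHV : Prop :=
  exists (L : choiceType) (q : L -> R)
    (rA : MA -> L -> O -> R) (rB : MB -> L -> O -> R),
  [/\ is_pmf q,
      forall j l, is_pmf (rA j l),
      forall j l, is_pmf (rB j l) &
      forall CA CB, (CA, CB) \in tested ->
      forall (a : outcomes CA) (b : outcomes CB),
        ((p a b)%:E =
         \esum_(l in [set: L]%classic)
           (q l * ((\prod_(j : {j : MA | j \in CA}) rA (val j) l (a j)) *
                   (\prod_(j : {j : MB | j \in CB}) rB (val j) l (b j))))%:E)%E].

Definition globally_contextual : Prop := [/\ NCHV_local, GLHV & ~ GNCHV].

End TwoParties.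
End HiddenVariables.

Section Quantum.
Variable R : realType.

Definition adjoint (m n : nat) (A : 'M[R[i]]_(m, n)) : 'M[R[i]]_(n, m) :=
  map_mx Num.conj A^T.

Definition ket (n : nat) (i : 'I_n) : 'cV[R[i]]_n := delta_mx i 0.

Definition ketbra (n : nat) (v : 'cV[R[i]]_n) : 'M[R[i]]_n := v *m adjoint v.

Definition ptraceB (m n : nat) (rho : 'M[R[i]]_(m * n)) : 'M[R[i]]_m :=
  \matrix_(i, i') \sum_(k < n) rho (mxtens_index (i, k)) (mxtens_index (i', k)).

Definition ptraceA (m n : nat) (rho : 'M[R[i]]_(m * n)) : 'M[R[i]]_n :=
  \matrix_(k, k') \sum_(i < m) rho (mxtens_index (i, k)) (mxtens_index (i, k')).

(* Outcomes of a +1/-1-valued observable X (Hermitian, X ^ 2 = 1) are labelled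
   by booleans: false stands for +1 and true for -1, i.e. b stands for
   (-1) ^+ b.  For such X the spectral projector onto the eigenspace of
   s = 1 or s = -1 is (1 + s X) / 2. *)
Definition spectral_proj (d : nat) (X : 'M[R[i]]_d) (b : bool) : 'M[R[i]]_d :=
  2^-1 *: (1%:M + (-1) ^+ b *: X).

Lemma spectral_projP (d : nat) (X : 'M[R[i]]_d) (b : bool) :
  X *m X = 1%:M ->
  X *m spectral_proj X b = (-1) ^+ b *: spectral_proj X b /\
  spectral_proj X b *m spectral_proj X b = spectral_proj X b.
Proof.
move=> h.
have e : X *m spectral_proj X b = (-1) ^+ b *: spectral_proj X b.
  rewrite /spectral_proj -scalemxAr mulmxDr mulmx1 -scalemxAr h.
  rewrite [RHS]scalerA [X in _ = X *: _]mulrC -[RHS]scalerA; congr (_ *: _).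
  by rewrite scalerDr scalerA -expr2 sqrr_sign scale1r addrC.
split=> //; rewrite {1}/spectral_proj -scalemxAl mulmxDl mul1mx -scalemxAl e.
rewrite scalerA -expr2 sqrr_sign scale1r -mulr2n -[X in _ *: X = _]scaler_nat scalerA.
by rewrite mulVf ?scale1r // pnatr_eq0.
Qed.

Definition compatible (d : nat) (M : finType) (obs : M -> 'M[R[i]]_d)
    (C : {set M}) : Prop :=
  forall j k, j \in C -> k \in C -> obs j *m obs k = obs k *m obs j.

(* Projector of the joint measurement of the observables in a compatible set;
   the factors then commute, so their order is immaterial. *)
Definition joint_proj (d : nat) (M : finType) (obs : M -> 'M[R[i]]_d)
    (C : {set M}) (m : outcomes bool C) : 'M[R[i]]_d :=
  \big[mulmx/1%:M]_(j : {j : M | j \in C}) spectral_proj (obs (val j)) (m j).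

(* The trace is real when rho and P are Hermitian. *)
Definition born (d : nat) (rho P : 'M[R[i]]_d) : R := complex.Re (\tr (rho *m P)).

Definition born_local (d : nat) (rho : 'M[R[i]]_d) (M : finType)
    (obs : M -> 'M[R[i]]_d) (C : {set M}) (m : outcomes bool C) : R :=
  born rho (joint_proj obs m).

Definition born_joint (dA dB : nat) (rho : 'M[R[i]]_(dA * dB)) (MA MB : finType)
    (obsA : MA -> 'M[R[i]]_dA) (obsB : MB -> 'M[R[i]]_dB)
    (CA : {set MA}) (CB : {set MB})
    (a : outcomes bool CA) (b : outcomes bool CB) : R :=
  born rho (joint_proj obsA a *t joint_proj obsB b).

End Quantum.

Arguments born_local {R d} rho {M} obs C m.
Arguments born_joint {R dA dB} rho {MA MB} obsA obsB CA CB a b.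

Section Experiment.
Variable R : realType.

Definition psi (c0 c1 : R) : 'cV[R[i]]_(2 * 3) :=
  c0%:C *: (ket R (0 : 'I_2) *t ket R (0 : 'I_3)) +
  c1%:C *: (ket R (1 : 'I_2) *t ket R (1 : 'I_3)).

Definition sigma_z : 'M[R[i]]_2 := delta_mx 0 0 - delta_mx 1 1.
Definition sigma_x : 'M[R[i]]_2 := delta_mx 0 1 + delta_mx 1 0.

(* The index 0 is A_1 and the index 1 is A_2. *)
Definition alice_obs (x : 'I_2) : 'M[R[i]]_2 :=
  if x == 0 then sigma_z else sigma_x.

Definition bob_vec (theta : R) (j : 'Z_5) : 'cV[R[i]]_3 :=
  (cos theta)%:C *: ket R (0 : 'I_3) +
  (sin theta * cos (4 * pi * j%:R / 5))%:C *: ket R (1 : 'I_3) +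
  (sin theta * sin (4 * pi * j%:R / 5))%:C *: ket R (2 : 'I_3).

Definition bob_obs (theta : R) (j : 'Z_5) : 'M[R[i]]_3 :=
  1%:M - 2 *: ketbra (bob_vec theta j).

Definition alice_ctx : {set {set 'I_2}} := [set [set x] | x : 'I_2].

Definition bob_ctx : {set {set 'Z_5}} := [set [set j; j + 1] | j : 'Z_5].

Definition tested_ctx : {set {set 'I_2} * {set 'Z_5}} :=
  finset.setX alice_ctx bob_ctx.

End Experiment.

(* Main.v *)
(** Bob's projectors onto adjacent v_j, v_(j+1) are orthogonal, so the joint
    measurement of a context has only the outcomes (-,+), (+,-), (+,+), and every
    probability is an explicit function of cos theta, sin theta and the numbers
    cos (4 pi j / 5), which lie in Q(sqrt 5).

    - Bob alone: with P_j the probability of outcome -1, the weights P_2, P_2,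
      P_1, P_0 - 2 P_2 and 1 - P_0 - P_1 on the independent sets {0,2}, {0,3},
      {1,4}, {0} and {} of the 5-cycle are nonnegative and reproduce the data
      (P_4 = P_1 and P_3 = P_2).
    - GLHV: each Bob outcome k satisfies p(A_1 = +, k) <= p(A_2 = +, k), so one
      may take the joint distribution of (A_1, A_2, k) in which A_1 = + forces
      A_2 = +; its (A_1, A_2)-marginal does not depend on Bob's context.
    - No GNCHV: given A_1 = +1 Bob's state is |0>, for which
      sum_j P(B_j = -1, B_(j+1) = +1) = 5 / sqrt 5 > 2, against the bound
      sum_j b_j (1 - b_(j+1)) <= 2 on the cube [0, 1]^5. *)

Require Import Defs.
From HB Require Import structures.
From mathcomp Require Import all_boot all_order all_algebra.
From mathcomp Require Import complex mxtens.
From mathcomp Require Import all_classical all_reals all_analysis.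
From mathcomp Require Import ring lra.
Set Implicit Arguments.
Unset Strict Implicit.
Unset Printing Implicit Defensive.

Import Order.TTheory GRing.Theory Num.Theory.
Local Open Scope ring_scope.
Local Open Scope complex_scope.

(** * Trigonometry and exact statistics *)

Lemma cos_double (R : realType) (x : R) : cos (x + x) = 2 * cos x ^+ 2 - 1.
Proof. by rewrite -mulr2n cos_mulr2n mulr_natl. Qed.

Lemma cos_triple (R : realType) (x : R) :
  cos (x + x + x) = 4 * cos x ^+ 3 - 3 * cos x.
Proof.
rewrite cosD cos_double sinD; have := sin2cos2 x.

move: (sin x) (cos x) => s c e.
have -> : (s * c + c * s) * s = 2 * c * s ^+ 2 by ring.
rewrite e; ring.
Qed.

Lemma cos_4pi5 (R : realType) : cos (4 * pi / 5 : R) = - (1 + Num.sqrt 5) / 4.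
Proof.
have p0 := pi_gt0 R.
set a : R := 4 * pi / 5; set s := Num.sqrt 5.
have s2 : s ^+ 2 = 5 by rewrite sqr_sqrtr.
have s0 : 0 <= s by exact: sqrtr_ge0.
have c_lt0 : cos a < 0.
  have -> : a = - (pi / 5) + pi by rewrite /a; field.
  by rewrite cosDpi cosN oppr_lt0 cos_gt0_pihalf //; apply/andP; split; lra.
(* 5a = 4pi, so cos 3a = cos 2a; the factor c - 1 of the resulting cubic
   does not vanish. *)
have e32 : cos (a + a + a) = cos (a + a).
  have -> : a + a + a = - (a + a) + pi *+ 2 + pi *+ 2 by rewrite /a; field.
  by rewrite !cosD2pi cosN.
move: e32 c_lt0; rewrite cos_triple cos_double; move: (cos a) => c e32 c_lt0.
have e : (c - 1) * ((c - (- (1 + s) / 4)) * (c - (s - 1) / 4)) = 0.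
  have -> : (c - 1) * ((c - (- (1 + s) / 4)) * (c - (s - 1) / 4)) =
    (c - 1) * (c ^+ 2 + c / 2 + (1 - s ^+ 2) / 16) by field.
  by rewrite s2; lra.
move/eqP: e; rewrite !mulf_eq0 !subr_eq0 => /or3P[]/eqP e //; first by lra.
(* The remaining root [(s - 1) / 4] is nonnegative, which [c_lt0] excludes. *)
have : 1 <= s by nra.
lra.
Qed.

Definition bob_cos (R : realType) (j : 'Z_5) : R := cos (4 * pi * j%:R / 5).
Definition bob_sin (R : realType) (j : 'Z_5) : R := sin (4 * pi * j%:R / 5).

Lemma bob_cosE (R : realType) (j : 'Z_5) (s := Num.sqrt 5 : R) :
  bob_cos R j =
  nth 0 [:: 1; - (1 + s) / 4; (s - 1) / 4; (s - 1) / 4; - (1 + s) / 4] j.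
Proof.
set a : R := 4 * pi / 5.
have s2 : s ^+ 2 = 5 by rewrite sqr_sqrtr.
have c1 : cos a = - (1 + s) / 4 by exact: cos_4pi5.
have c2 : cos (a + a) = (s - 1) / 4.
  rewrite cos_double c1.
  have -> : 2 * (- (1 + s) / 4) ^+ 2 - 1 = (1 + 2 * s + s ^+ 2) / 8 - 1 by field.
  by rewrite s2; field.
rewrite /bob_cos; case: j => -[|[|[|[|[|//]]]]] /= _.
- by rewrite mulr0 mul0r cos0.
- by rewrite mulr1.
- by rewrite -c2; congr cos; rewrite /a; field.
(* Since 5a = 4 pi, the angles 3a and 4a are -2a and -a up to two full turns. *)
- rewrite -c2 -[in RHS]cosN; set x := (X in cos X = _).
  have -> : x = - (a + a) + pi *+ 2 + pi *+ 2 by rewrite /x /a; field.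
  by rewrite !cosD2pi.
- rewrite -c1 -[in RHS]cosN; set x := (X in cos X = _).
  have -> : x = - a + pi *+ 2 + pi *+ 2 by rewrite /x /a; field.
  by rewrite !cosD2pi.
Qed.

(** The left side is the cosine of the difference of two consecutive angles, which is 4 pi / 5 up to
    sign and full turns, also across the wrap from 4 to 0. *)
Lemma cos_adjacent (R : realType) (j : 'Z_5) :
  bob_cos R j * bob_cos R (j + 1) + bob_sin R j * bob_sin R (j + 1) =
  - (1 + Num.sqrt 5) / 4.
Proof.
rewrite -cos_4pi5 /bob_cos /bob_sin -cosB.
case: j => -[|[|[|[|[|//]]]]] /= _; rewrite ?mulr0 ?mul0r.
- by rewrite sub0r cosN mulr1.
- by rewrite -[in RHS]cosN -[((1 + _) %% _)%N]/2%N; congr cos; field.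
- by rewrite -[in RHS]cosN -[((2 + _) %% _)%N]/3%N; congr cos; field.
- by rewrite -[in RHS]cosN -[((3 + _) %% _)%N]/4%N; congr cos; field.
- rewrite subr0 -[in RHS]cosN; set a := (X in _ = cos X).
  set x := (X in cos X = _).
  have -> : x = a + pi *+ 2 + pi *+ 2 by rewrite /x /a; field.
  by rewrite !cosD2pi.
Qed.

(** * Closed forms and bounds for the probabilities *)

Section BobStatistics.
Context (R : realType) (theta : R).
Hypotheses (cos_gt0 : 0 < cos theta) (sin_gt0 : 0 < sin theta).
Hypothesis cos2E : cos theta ^+ 2 = (Num.sqrt 5)^-1.
Implicit Types (j : 'Z_5) (x y : bool).

Let s : R := Num.sqrt 5.
Let s2 : s ^+ 2 = 5. Proof. by rewrite sqr_sqrtr. Qed.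
Let s_ge0 : 0 <= s. Proof. exact: sqrtr_ge0. Qed.
Let s_bounds : 223 / 100 <= s <= 224 / 100.
Proof.
move: s s2 s_ge0 => r r2 r0.
by apply/andP; split; rewrite leNgt; apply/negP => h; nra.
Qed.

Let ct2 : cos theta ^+ 2 = s / 5.
Proof.
have s0 : s != 0 by by apply: lt0r_neq0; have /andP[] := s_bounds; lra.
by rewrite cos2E -/s -s2; field.
Qed.

Let st2 : sin theta ^+ 2 = 1 - s / 5.
Proof. by rewrite sin2cos2 ct2. Qed.

(* Entries (0, 0), (0, 1) and (1, 1) of the projector for the outcomes x, y
   of the adjacent observables j, j + 1. *)
Definition proj_entry (f : 'Z_5 -> R) (d : R) j x y : R :=
  if x then (if y then 0 else f j)
  else (if y then f (j + 1) else d - f j - f (j + 1)).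

Definition entry00 := proj_entry (fun=> cos theta ^+ 2) 1.
Definition entry01 :=
  proj_entry (fun j => cos theta * (sin theta * bob_cos R j)) 0.
Definition entry11 := proj_entry (fun j => (sin theta * bob_cos R j) ^+ 2) 1.

Lemma bob_vec_orthogonal j :
  cos theta * cos theta +
  (sin theta * bob_cos R j) * (sin theta * bob_cos R (j + 1)) +
  (sin theta * bob_sin R j) * (sin theta * bob_sin R (j + 1)) = 0.
Proof.
have := cos_adjacent R j.
move: (bob_cos R j) (bob_cos R (j + 1)) => a b.
move: (bob_sin R j) (bob_sin R (j + 1)) => c d e.
have -> : cos theta * cos theta + sin theta * a * (sin theta * b) +
  sin theta * c * (sin theta * d) =
  cos theta ^+ 2 + sin theta ^+ 2 * (a * b + c * d) by ring.
rewrite e -/s ct2 st2.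
have -> : s / 5 + (1 - s / 5) * (- (1 + s) / 4) = (s ^+ 2 - 5) / 20 by field.
by rewrite s2 subrr mul0r.
Qed.

Context (c0 c1 : R).
Hypotheses (c0E : c0 = 1 / 4) (c1E : c1 = Num.sqrt (1 - c0 ^+ 2)).

Let c02 : c0 ^+ 2 = 1 / 16. Proof. by rewrite c0E; field. Qed.
Let c12 : c1 ^+ 2 = 15 / 16.
Proof. by rewrite c1E sqr_sqrtr c02; lra. Qed.
Let c1_ge0 : 0 <= c1. Proof. by rewrite c1E sqrtr_ge0. Qed.

(** The rescaled interference term, with u^2 = 3 s - 3. The probabilities below are affine in s, u
    and u s, so rational bounds on these three let linear arithmetic decide every sign. *)
Let u : R := 16 * (c0 * c1 * (cos theta * sin theta)).

Let u_bounds : 192 / 100 <= u <= 193 / 100.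
Proof.
have u2 : u ^+ 2 = 3 * s - 3.
  have -> : u ^+ 2 =
    256 * (c0 ^+ 2 * c1 ^+ 2 * (cos theta ^+ 2 * sin theta ^+ 2)).
    by rewrite /u; ring.
  rewrite c02 c12 ct2 st2.
  have -> : 256 * (1 / 16 * (15 / 16) * (s / 5 * (1 - s / 5))) =
    3 * s - 3 / 5 * s ^+ 2 by field.
  by rewrite s2; field.
have u0 : 0 <= u.
  by rewrite /u !mulr_ge0 ?(ltW cos_gt0) ?(ltW sin_gt0) // c0E; lra.
move: u s u2 u0 s_bounds => v r v2 v0 /andP[rl ru].
by apply/andP; split; rewrite leNgt; apply/negP => h; nra.
Qed.

Let us_bounds : 428 / 100 <= u * s <= 433 / 100.
Proof.
move: u s u_bounds s_bounds => v r /andP[ul uu] /andP[sl su].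
by apply/andP; split; nra.
Qed.

Let bob_sqrE j : (sin theta * bob_cos R j) ^+ 2 =
  nth 0 [:: 1 - s / 5; (5 + s) / 20; (5 - 2 * s) / 10;
            (5 - 2 * s) / 10; (5 + s) / 20] j.
Proof.
rewrite exprMn st2 bob_cosE -/s.
have e1 : (1 - s / 5) * (- (1 + s) / 4) ^+ 2 = (5 + s) / 20.
  have -> : (1 - s / 5) * (- (1 + s) / 4) ^+ 2 =
    (1 + 2 * s + s ^+ 2) / 16 - (s + 2 * s ^+ 2 + s ^+ 2 * s) / 80 by field.
  by rewrite s2; field.
have e2 : (1 - s / 5) * ((s - 1) / 4) ^+ 2 = (5 - 2 * s) / 10.
  have -> : (1 - s / 5) * ((s - 1) / 4) ^+ 2 =
    (1 - 2 * s + s ^+ 2) / 16 - (s - 2 * s ^+ 2 + s ^+ 2 * s) / 80 by field.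
  by rewrite s2; field.
case: j => -[|[|[|[|[|//]]]]] //= _.
by rewrite expr1n mulr1.
Qed.

Let bob_crossE j : c0 * c1 * (cos theta * (sin theta * bob_cos R j)) =
  nth 0 [:: u / 16; - (u + u * s) / 64; (u * s - u) / 64;
            (u * s - u) / 64; - (u + u * s) / 64] j.
Proof.
have -> : c0 * c1 * (cos theta * (sin theta * bob_cos R j)) =
  u / 16 * bob_cos R j by rewrite /u; field.
rewrite bob_cosE -/s.
by case: j => -[|[|[|[|[|//]]]]] /= _; field.
Qed.

(** Outcome [a] of A_1 leaves Bob, unnormalised, in c0 |0> or c1 |1>; outcome [a] of A_2 leaves him
    in (c0 |0> + c1 |1>) / sqrt 2 or (c0 |0> - c1 |1>) / sqrt 2. The value is the expectation of his
    projector in that vector. *)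
Definition joint_prob (x : 'I_2) (a : bool) j y z : R :=
  if x == 0 then
    if a then c1 ^+ 2 * entry11 j y z else c0 ^+ 2 * entry00 j y z
  else (c0 ^+ 2 * entry00 j y z + c1 ^+ 2 * entry11 j y z +
        (-1) ^+ a * (2 * (c0 * c1 * entry01 j y z))) / 2.

Definition bob_prob j y z : R :=
  c0 ^+ 2 * entry00 j y z + c1 ^+ 2 * entry11 j y z.

Lemma entry00_ge0 j y z : 0 <= entry00 j y z.
Proof.
by rewrite /entry00 /proj_entry ct2; case: y; case: z => //; move/andP: s_bounds; lra.
Qed.

Let joint_prob_projE a j y z :
  joint_prob 1 a j y z =
  proj_entry (fun j => (s / 80 + 15 / 16 * (sin theta * bob_cos R j) ^+ 2 +
     (-1) ^+ a * (2 * (c0 * c1 * (cos theta * (sin theta * bob_cos R j)))))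
     / 2)
  (1 / 2) j y z.
Proof.
rewrite /joint_prob /entry00 /entry01 /entry11 /proj_entry /= ct2 c02 c12.
by case: y; case: z; field.
Qed.

(** The critical case is A_2 = -1 with B_2 = -1 (or B_3 = -1), of probability about 0.0015; it
    dictates how sharp the bounds on s, u and u s must be. *)
Lemma joint_prob_x_ge0 a j y z : 0 <= joint_prob 1 a j y z.
Proof.
rewrite joint_prob_projE /proj_entry !bob_sqrE !bob_crossE.
move: s u s_bounds u_bounds us_bounds => r v.
move=> /andP[sl su] /andP[ul uu]; move: (v * r) => w /andP[wl wu].
case: j => -[|[|[|[|[|//]]]]] //= _; case: a; case: y; case: z => /=;
  rewrite ?expr0 ?expr1; lra.
Qed.

(** This domination makes the middle entry of [bell_block] nonnegative. *)
Lemma joint_prob_zx j y z : joint_prob 0 false j y z <= joint_prob 1 false j y z.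
Proof.
rewrite joint_prob_projE /joint_prob /= /entry00 /proj_entry ct2 c02.
rewrite !bob_sqrE !bob_crossE.
move: s u s_bounds u_bounds us_bounds => r v.
move=> /andP[sl su] /andP[ul uu]; move: (v * r) => w /andP[wl wu].
case: j => -[|[|[|[|[|//]]]]] //= _; case: y; case: z => /=;
  rewrite ?expr0 ?expr1; lra.
Qed.

Lemma joint_prob_nosignal (x : 'I_2) j y z :
  joint_prob x false j y z + joint_prob x true j y z = bob_prob j y z.
Proof.
by rewrite /joint_prob /bob_prob expr0 expr1; case: ifP => _; field.
Qed.

(** The listed indices get [true], the outcome -1. No list contains two neighbours modulo 5, so (-1,
    -1) never occurs in a context. *)
Definition bob_strategy (l : 'I_5) j : bool :=
  nat_of_ord j \in nth [::] [:: [:: 0; 2]; [:: 0; 3]; [:: 1; 4]; [:: 0]; [::]]%N l.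

(** [P j] is the probability of B_j = -1, read off from the outcome (-1, +1) because (-1, -1) has
    probability 0. *)
Definition bob_weight (l : 'I_5) : R :=
  let P j := bob_prob j true false in
  nth 0 [:: P 2; P 2; P 1; P 0 - 2 * P 2; 1 - P 0 - P 1] l.

Let bob_probE j y z : bob_prob j y z =
  proj_entry (fun j => s / 80 + 15 / 16 * (sin theta * bob_cos R j) ^+ 2) 1 j y z.
Proof.
rewrite /bob_prob /entry00 /entry11 /proj_entry ct2 c02 c12.
by case: y; case: z; field.
Qed.

Lemma bob_weight_ge0 l : 0 <= bob_weight l.
Proof.
rewrite /bob_weight !bob_probE /proj_entry !bob_sqrE.
move: s s_bounds => r /andP[rl ru].
by case: l => -[|[|[|[|[|//]]]]] /= _; lra.
Qed.

Lemma sum_bob_weight : \sum_l bob_weight l = 1.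
Proof.
rewrite !big_ord_recl big_ord0 /bob_weight !bob_probE /proj_entry !bob_sqrE /=.
by field.
Qed.

Lemma bob_model j y z :
  \sum_l bob_weight l *
    ((y == bob_strategy l j)%:R * (z == bob_strategy l (j + 1))%:R) =
  bob_prob j y z.
Proof.
rewrite !big_ord_recl big_ord0 /bob_weight !bob_probE /proj_entry !bob_sqrE.
rewrite /bob_strategy.
by case: j => -[|[|[|[|[|//]]]]] lt5 /=; case: y; case: z => /=; field.
Qed.

End BobStatistics.

(** * Born rule *)

Lemma sum_tens_index (V : nmodType) (m n : nat) (F : 'I_(m * n) -> V) :
  \sum_x F x = \sum_i \sum_k F (mxtens_index (i, k)).
Proof.
rewrite pair_big /= (reindex (@mxtens_index m n)) /=.
  by apply: eq_bigr => -[].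
by exists (@mxtens_unindex m n) => x _; rewrite (mxtens_indexK, mxtens_unindexK).
Qed.

Lemma mxtrace_mul_tens (R : comNzRingType) (m n : nat) (rho : 'M[R]_(m * n))
    (P : 'M[R]_m) (Q : 'M[R]_n) :
  \tr (rho *m (P *t Q)) = \sum_i \sum_k \sum_i' \sum_k'
    rho (mxtens_index (i, k)) (mxtens_index (i', k')) * (P i' i * Q k' k).
Proof.
rewrite /mxtrace sum_tens_index; apply: eq_bigr => i _; apply: eq_bigr => k _.
rewrite mxE sum_tens_index; apply: eq_bigr => i' _; apply: eq_bigr => k' _.
by rewrite tensmxE.
Qed.

(** Moves local statistics to the full state, so that one formula for [psi] serves local and joint
    probabilities alike. *)
Lemma born_ptraceA (R : realType) (m n : nat) (rho : 'M[R[i]]_(m * n)) Q :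
  born (ptraceA rho) Q = born rho (1%:M *t Q).
Proof.
rewrite /born mxtrace_mul_tens; congr complex.Re.
rewrite /mxtrace exchange_big /=; apply: eq_bigr => k _.
rewrite mxE; transitivity (\sum_(i < m) \sum_(k' < n)
   rho (mxtens_index (i, k)) (mxtens_index (i, k')) * Q k' k).
  by rewrite exchange_big /=; apply: eq_bigr => k' _; rewrite mxE mulr_suml.
apply: eq_bigr => i _; rewrite exchange_big /=; apply: eq_bigr => k' _.
rewrite (bigD1 i) //= big1 ?addr0 => [|i' ne]; rewrite mxE.
  by rewrite eqxx mul1r.
by rewrite (negPf ne) mul0r mulr0.
Qed.

Lemma born_ptraceB (R : realType) (m n : nat) (rho : 'M[R[i]]_(m * n)) P :
  born (ptraceB rho) P = born rho (P *t 1%:M).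
Proof.
rewrite /born mxtrace_mul_tens; congr complex.Re.
apply: eq_bigr => i _; rewrite mxE exchange_big /=.
apply: eq_bigr => i' _; rewrite mxE mulr_suml; apply: eq_bigr => k _.
rewrite (bigD1 k) //= big1 ?addr0 => [|k' ne]; rewrite mxE.
  by rewrite eqxx mulr1.
by rewrite (negPf ne) !mulr0.
Qed.

Lemma ketbra_realE (R : realType) (n : nat) (v : 'cV[R[i]]_n) (w : 'I_n -> R) i j :
  (forall i, v i 0 = (w i)%:C) -> ketbra v i j = (w i * w j)%:C.
Proof.
move=> vE; rewrite /ketbra mxE big_ord_recl big_ord0 addr0 !mxE !vE.
rewrite rmorphM /=; congr (_ * _).
exact: conjc_real.
Qed.

Lemma psiE (R : realType) (c0 c1 : R) (i : 'I_2) (k : 'I_3) :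
  psi c0 c1 (mxtens_index (i, k)) 0 =
  (c0 * ((i == 0) && (k == 0))%:R + c1 * ((i == 1) && (k == 1))%:R)%:C.
Proof.
rewrite /psi /ket !mxE !mxtens_indexK /=.
have e (z : 'I_1) : (z == 0) = true by rewrite ord1.
rewrite !e !andbT.
by rewrite rmorphD !rmorphM !rmorph_nat -!natrM !mulnb.
Qed.

(** [psi] is supported on |00> and |11>, so Bob's level |2> drops out. This is why [entry00],
    [entry01] and [entry11] suffice to describe his real symmetric projectors. *)
Lemma born_psiE (R : realType) (c0 c1 : R) (P : 'M[R[i]]_2) (Q : 'M[R[i]]_3) :
  born (ketbra (psi c0 c1)) (P *t Q) = complex.Re (
    (c0 ^+ 2)%:C * (P 0 0 * Q 0 0) + (c1 ^+ 2)%:C * (P 1 1 * Q 1 1) +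
    (c0 * c1)%:C * (P 0 1 * Q 0 1 + P 1 0 * Q 1 0)).
Proof.
rewrite /born mxtrace_mul_tens; congr complex.Re.
pose S (i : 'I_2) (k : 'I_3) : R[i] :=
  (c0 * ((i == 0) && (k == 0))%:R + c1 * ((i == 1) && (k == 1))%:R)%:C.
have rhoE i k i' k' :
  ketbra (psi c0 c1) (mxtens_index (i, k)) (mxtens_index (i', k')) =
  S i k * S i' k'.
  rewrite (@ketbra_realE _ _ _ (fun x => let: (i, k) := mxtens_unindex x in
    c0 * ((i == 0) && (k == 0))%:R + c1 * ((i == 1) && (k == 1))%:R)).
    by rewrite !mxtens_indexK rmorphM.
  by move=> x; case: (mxtens_indexP x) => a b; rewrite psiE mxtens_indexK.
have SE F : \sum_(i < 2) \sum_(k < 3) S i k * F i k =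
    c0%:C * F 0 0 + c1%:C * F 1 1.
  rewrite big_ord_recl big_ord_recl big_ord0 addr0.
  have -> : lift ord0 ord0 = 1 :> 'I_2 by apply: val_inj.
  congr (_ + _).
    rewrite (bigD1 0) //= big1 => [|k /negPf k0]; rewrite /S ?k0 /=.
      by rewrite !mulr1 mulr0 !addr0.
    by rewrite !mulr0 addr0 mul0r.
  rewrite (bigD1 1) //= big1 => [|k /negPf k0]; rewrite /S ?k0 /=.
    by rewrite mulr0 mulr1 add0r addr0.
  by rewrite !mulr0 addr0 mul0r.
(* The density matrix is a product of two copies of [S], so [SE] collapses first the inner double
   sum, then the outer one. *)
transitivity (\sum_(i < 2) \sum_(k < 3) S i k *
    \sum_(i' < 2) \sum_(k' < 3) S i' k' * (P i' i * Q k' k)).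
  apply: eq_bigr => i _; apply: eq_bigr => k _; rewrite mulr_sumr.
  apply: eq_bigr => i' _; rewrite mulr_sumr.
  by apply: eq_bigr => k' _; rewrite rhoE -mulrA.
under eq_bigr do under eq_bigr do rewrite SE.
rewrite SE !expr2 !rmorphM /=; ring.
Qed.

(** * Contexts with one or two members *)

Definition ctx_fst (M : finType) (a b : M) : {j : M | j \in [set a; b]} :=
  exist _ a (set21 a b).
Definition ctx_snd (M : finType) (a b : M) : {j : M | j \in [set a; b]} :=
  exist _ b (set22 a b).
Definition ctx_one (M : finType) (a : M) : {j : M | j \in [set a]} :=
  exist _ a (set11 a).

Lemma ctx_oneP (M : finType) (a : M) (k : {j : M | j \in [set a]}) :
  k = ctx_one a.
Proof. by apply: val_inj; case: k => k /= /set1P. Qed.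

Lemma ctx_pairP (M : finType) (a b : M) (k : {j : M | j \in [set a; b]}) :
  k = ctx_fst a b \/ k = ctx_snd a b.
Proof.
by case: k => k kab; case/set2P: (kab) => e; [left|right]; apply: val_inj.
Qed.

Lemma big_ctx_one (T : Type) (idx : T) (op : T -> T -> T) (M : finType) (a : M)
    (F : {j : M | j \in [set a]} -> T) :
  right_id idx op -> \big[op/idx]_k F k = F (ctx_one a).
Proof.
move=> opx1; rewrite (_ : index_enum _ = [:: ctx_one a]).
  by rewrite big_cons big_nil opx1.
apply: perm_small_eq => //; apply: uniq_perm => [||k]; rewrite ?index_enum_uniq //.
by rewrite mem_index_enum (ctx_oneP k) inE eqxx.
Qed.

(** The enumeration may list the two members in either order, hence the commutation of the two
    factors. A raw operation with a right unit covers both matrix products and products of reals. *)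
Lemma big_ctx_pair (T : Type) (idx : T) (op : T -> T -> T) (M : finType)
    (a b : M) (F : {j : M | j \in [set a; b]} -> T) :
  right_id idx op -> a != b ->
  op (F (ctx_fst a b)) (F (ctx_snd a b)) = op (F (ctx_snd a b)) (F (ctx_fst a b)) ->
  \big[op/idx]_k F k = op (F (ctx_fst a b)) (F (ctx_snd a b)).
Proof.
move=> opx1 ab opC.
have ne : ctx_fst a b != ctx_snd a b by rewrite -val_eqE.
have : perm_eq (index_enum {j : M | j \in [set a; b]})
    [:: ctx_fst a b; ctx_snd a b].
  apply: uniq_perm => [||k]; first exact: index_enum_uniq.
    by rewrite /= inE ne.
  by rewrite mem_index_enum !inE; case: (ctx_pairP k) => ->; rewrite eqxx ?orbT.
(* A duplicate-free enumeration of length two leaves just the two orders. *)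
case: (index_enum _) => [|x [|y [|z r]]] /[dup] /perm_size //= _ /perm_uniq.
rewrite /= !inE ne andbT.
case: (ctx_pairP x) (ctx_pairP y) => -> [] ->; rewrite ?eqxx // => _.
- by rewrite !big_cons big_nil opx1.
- by rewrite !big_cons big_nil opx1 opC.
Qed.

Lemma spectral_proj_comm (R : realType) (d : nat) (X Y : 'M[R[i]]_d) x y :
  X *m Y = Y *m X ->
  spectral_proj X x *m spectral_proj Y y = spectral_proj Y y *m spectral_proj X x.
Proof.
move=> XY; rewrite /spectral_proj -!scalemxAl -!scalemxAr; do 2 congr (_ *: _).
rewrite !mulmxDl !mulmxDr !mul1mx !mulmx1 -!scalemxAl -!scalemxAr XY.
rewrite scalerA [(-1) ^+ x * _]mulrC -scalerA.
by rewrite !addrA; congr (_ + _); rewrite -!addrA [_ *: Y + _]addrC.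
Qed.

Lemma joint_proj_one (R : realType) (d : nat) (M : finType)
    (obs : M -> 'M[R[i]]_d) (a : M) (m : outcomes bool [set a]) :
  joint_proj obs m = spectral_proj (obs a) (m (ctx_one a)).
Proof. by rewrite /joint_proj (big_ctx_one _ (@mulmx1 _ _ _)). Qed.

Lemma joint_proj_pair (R : realType) (d : nat) (M : finType)
    (obs : M -> 'M[R[i]]_d) (a b : M) (m : outcomes bool [set a; b]) :
  a != b -> obs a *m obs b = obs b *m obs a ->
  joint_proj obs m =
  spectral_proj (obs a) (m (ctx_fst a b)) *m spectral_proj (obs b) (m (ctx_snd a b)).
Proof.
move=> ab abC.
pose F k := spectral_proj (obs (val k)) (m k).
have := @big_ctx_pair _ 1%:M (@mulmx _ d d d) M a b F (@mulmx1 _ d d) ab.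
by apply; exact: spectral_proj_comm.
Qed.

Lemma sum_outcomes_pair (V : nmodType) (M : finType) (a b : M)
    (F : bool -> bool -> V) : a != b ->
  \sum_(m : outcomes bool [set a; b]) F (m (ctx_fst a b)) (m (ctx_snd a b)) =
  \sum_x \sum_y F x y.
Proof.
move=> ab; rewrite pair_big /=.
rewrite (reindex (fun p : bool * bool =>
  [ffun k => if val k == a then p.1 else p.2] : outcomes bool [set a; b])).
  by apply: eq_bigr => -[x y] _; rewrite !ffunE /= eqxx eq_sym (negPf ab).
exists (fun m : outcomes bool [set a; b] => (m (ctx_fst a b), m (ctx_snd a b))) => [[x y] _|m _].
  by rewrite !ffunE /= eqxx eq_sym (negPf ab).
apply/ffunP => k; rewrite ffunE; case: (ctx_pairP k) => -> /=.
  by rewrite eqxx.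
by rewrite eq_sym (negPf ab).
Qed.

Lemma Z5_succ_neq (j : 'Z_5) : j != j + 1.
Proof. by case: j => -[|[|[|[|[|//]]]]]. Qed.

Lemma comm_reflection (R : realType) (d : nat) (X Y : 'M[R[i]]_d) :
  X *m Y = Y *m X ->
  (1%:M - 2 *: X) *m (1%:M - 2 *: Y) = (1%:M - 2 *: Y) *m (1%:M - 2 *: X).
Proof.
move=> e; rewrite !mulmxBl !mulmxBr !mul1mx !mulmx1 -!scalemxAl -!scalemxAr e.
rewrite !opprB -!addrA; congr (_ + _).
by rewrite addrCA [in RHS]addrCA; congr (_ + _); exact: addrC.
Qed.

Lemma spectral_proj_reflection (R : realType) (d : nat) (X : 'M[R[i]]_d) x :
  spectral_proj (1%:M - 2 *: X) x = if x then X else 1%:M - X.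
Proof.
have n2 : (2 : R[i]) != 0 by rewrite pnatr_eq0.
rewrite /spectral_proj; apply: (scalerI n2); rewrite scalerA mulfV // scale1r.
case: x; rewrite ?expr0 ?expr1 ?scale1r ?scaleN1r.
  by rewrite opprB addrCA subrr addr0.
by rewrite addrA -mulr2n -scaler_nat scalerBr.
Qed.

Lemma mul_orthogonal_projs (R : realType) (d : nat) (X Y : 'M[R[i]]_d) (x y : bool) :
  X *m Y = 0 ->
  (if x then X else 1%:M - X) *m (if y then Y else 1%:M - Y) =
  if x then (if y then 0 else X) else (if y then Y else 1%:M - X - Y).
Proof.
move=> e; case: x; case: y => //.
- by rewrite mulmxBr mulmx1 e subr0.
- by rewrite mulmxBl mul1mx e subr0.
by rewrite mulmxBl mul1mx mulmxBr mulmx1 e subr0 addrAC.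
Qed.

Lemma entry_1BB (R : realType) (d : nat) (X Y : 'M[R[i]]_d) a b i k :
  X i k = a%:C -> Y i k = b%:C -> (1%:M - X - Y) i k = ((i == k)%:R - a - b)%:C.
Proof.
by move=> Xa Yb; rewrite !mxE Xa Yb !(rmorphB (real_complex R)) rmorph_nat.
Qed.

(** * Bob's observables and the entries of their joint projectors *)

Section BobObservables.
Context (R : realType) (theta : R).
Hypotheses (cos_gt0 : 0 < cos theta) (sin_gt0 : 0 < sin theta).
Hypothesis cos2E : cos theta ^+ 2 = (Num.sqrt 5)^-1.
Implicit Types (j : 'Z_5) (x y : bool).

Let coord j (i : 'I_3) : R :=
  nth 0 [:: cos theta; sin theta * bob_cos R j; sin theta * bob_sin R j] i.

Local Notation V j := (ketbra (bob_vec theta j)).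

Lemma bob_ketbraE j (i k : 'I_3) : V j i k = (coord j i * coord j k)%:C.
Proof.
apply: ketbra_realE => {k} l; rewrite /bob_vec !mxE !andbT /coord.
case: l => -[|[|[|//]]] ?; rewrite -!val_eqE /=.
- by rewrite mulr1 !mulr0 !addr0.
- by rewrite mulr1 !mulr0 add0r addr0.
- by rewrite mulr1 !mulr0 !add0r.
Qed.

(** The product of |v><v| and |w><w| is |v><w| times the inner product of v and w, which vanishes
    for neighbours. *)
Lemma bob_ketbra_mul j : V j *m V (j + 1) = 0 /\ V (j + 1) *m V j = 0.
Proof.
have orth k l : coord k 0 * coord l 0 + coord k 1 * coord l 1 +
    coord k 2 * coord l 2 = 0 -> V k *m V l = 0.
  move=> e; apply/matrixP => a b; rewrite mxE [RHS]mxE.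
  transitivity (\sum_t (coord k a * coord l b * (coord k t * coord l t))%:C).
    apply: eq_bigr => t _.
    transitivity ((coord k a * coord k t)%:C * (coord l t * coord l b)%:C).
      exact: f_equal2 (bob_ketbraE k a t) (bob_ketbraE l t b).
    move: (coord k a) (coord l b) (coord k t) (coord l t) => p q r z.
    by rewrite -(rmorphM (real_complex R)); congr (_%:C); ring.
  rewrite -(rmorph_sum (real_complex R)) -mulr_sumr !big_ord_recl big_ord0 addr0.
  have -> : lift ord0 ord0 = 1 :> 'I_3 by apply: val_inj.
  have -> : lift ord0 (lift ord0 ord0) = 2 :> 'I_3 by apply: val_inj.
  by rewrite addrA e mulr0.
have o := bob_vec_orthogonal cos2E j.
by split; apply: orth; rewrite /coord /= -o //; ring.
Qed.

Lemma bob_obs_comm j :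
  bob_obs theta j *m bob_obs theta (j + 1) = bob_obs theta (j + 1) *m bob_obs theta j.
Proof.
have [e1 e2] := bob_ketbra_mul j.
exact: comm_reflection (etrans e1 (esym e2)).
Qed.

Lemma spectral_proj_bob j x :
  spectral_proj (bob_obs theta j) x = if x then V j else 1%:M - V j.
Proof.
exact: spectral_proj_reflection.
Qed.

Lemma joint_proj_bob j (m : outcomes bool [set j; j + 1])
    (x := m (ctx_fst j (j + 1))) (y := m (ctx_snd j (j + 1))) :
  joint_proj (bob_obs theta) m = if x then (if y then 0 else V j)
    else (if y then V (j + 1) else 1%:M - V j - V (j + 1)).
Proof.
have [e1 e2] := bob_ketbra_mul j.
transitivity ((if x then V j else 1%:M - V j) *m
    (if y then V (j + 1) else 1%:M - V (j + 1))).
  apply: etrans (joint_proj_pair m (Z5_succ_neq j) (bob_obs_comm j)) _.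
  by congr (_ *m _); exact: spectral_proj_bob.
exact: mul_orthogonal_projs e1.
Qed.

Lemma joint_proj_bob_entries j (m : outcomes bool [set j; j + 1])
    (Q := joint_proj (bob_obs theta) m)
    (x := m (ctx_fst j (j + 1))) (y := m (ctx_snd j (j + 1))) :
  [/\ Q 0 0 = (entry00 theta j x y)%:C, Q 0 1 = (entry01 theta j x y)%:C,
      Q 1 0 = (entry01 theta j x y)%:C & Q 1 1 = (entry11 theta j x y)%:C].
Proof.
rewrite /Q joint_proj_bob /entry00 /entry01 /entry11 /proj_entry -/x -/y.
case: x; case: y.
- by rewrite !mxE.
- by rewrite !bob_ketbraE /coord /= -!expr2 [_ * cos theta]mulrC.
- by rewrite !bob_ketbraE /coord /= -!expr2 [_ * cos theta]mulrC.
- split; rewrite (entry_1BB (bob_ketbraE j _ _) (bob_ketbraE (j + 1) _ _)) /coord /=.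
  + by rewrite -!expr2.
  + by [].
  + by rewrite ![_ * cos theta]mulrC.
  + by rewrite -!expr2.
Qed.

End BobObservables.

(** * Born probabilities in closed form *)

Lemma born_psi_real (R : realType) (c0 c1 : R) (P : 'M[R[i]]_2) (Q : 'M[R[i]]_3)
    p00 p01 p10 p11 q00 q01 q10 q11 :
  P 0 0 = p00%:C -> P 0 1 = p01%:C -> P 1 0 = p10%:C -> P 1 1 = p11%:C ->
  Q 0 0 = q00%:C -> Q 0 1 = q01%:C -> Q 1 0 = q10%:C -> Q 1 1 = q11%:C ->
  born (ketbra (psi c0 c1)) (P *t Q) =
  c0 ^+ 2 * (p00 * q00) + c1 ^+ 2 * (p11 * q11) + c0 * c1 * (p01 * q01 + p10 * q10).
Proof.
move=> e1 e2 e3 e4 e5 e6 e7 e8; rewrite born_psiE e1 e2 e3 e4 e5 e6 e7 e8.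
rewrite -[RHS]/(complex.Re (_%:C)); congr complex.Re.
by rewrite !(rmorphD (real_complex R)) !(rmorphM (real_complex R))
  !(rmorphD (real_complex R)) !(rmorphM (real_complex R)).
Qed.

Lemma spectral_proj_alice (R : realType) (x : 'I_2) (a : bool)
    (P := spectral_proj (alice_obs R x) a) :
  [/\ P 0 0 = (if x == 0 then (~~ a)%:R else 1 / 2)%:C,
      P 0 1 = (if x == 0 then 0 else (-1) ^+ a / 2)%:C,
      P 1 0 = (if x == 0 then 0 else (-1) ^+ a / 2)%:C &
      P 1 1 = (if x == 0 then a%:R else 1 / 2)%:C].
Proof.
rewrite {}/P /spectral_proj /alice_obs /sigma_z /sigma_x; case: ifP => _;
  case: a; split; rewrite !mxE /= ?expr0 ?expr1 ?(rmorphM (real_complex R))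
    ?(fmorphV (real_complex R)) ?(rmorphN (real_complex R))
    ?(rmorph0 (real_complex R)) ?(rmorph1 (real_complex R)) ?(rmorph_nat (real_complex R)).
all: by field.
Qed.

Lemma entry_1 (R : realType) (n : nat) (i k : 'I_n) :
  (1%:M : 'M[R[i]]_n) i k = ((i == k)%:R)%:C.
Proof. by rewrite mxE rmorph_nat. Qed.

Lemma joint_proj_aliceE (R : realType) (x : 'I_2) (m : outcomes bool [set x]) :
  joint_proj (alice_obs R) m = spectral_proj (alice_obs R x) (m (ctx_one x)).
Proof. exact: joint_proj_one. Qed.

(** Alice's reduced state is diagonal with entries c0^2 and c1^2. Their sum is not simplified to 1,
    so the formula holds for all [c0] and [c1]. *)
Definition alice_prob (R : realType) (c0 c1 : R) (x : 'I_2) (a : bool) : R :=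
  if x == 0 then (if a then c1 ^+ 2 else c0 ^+ 2) else (c0 ^+ 2 + c1 ^+ 2) / 2.

Lemma born_aliceE (R : realType) (c0 c1 : R) (x : 'I_2) (m : outcomes bool [set x]) :
  born_local (ptraceB (ketbra (psi c0 c1))) (alice_obs R) [set x] m =
  alice_prob c0 c1 x (m (ctx_one x)).
Proof.
rewrite /born_local born_ptraceB joint_proj_aliceE.
have [e1 e2 e3 e4] := spectral_proj_alice R x (m (ctx_one x)).
rewrite (born_psi_real c0 c1 e1 e2 e3 e4 (entry_1 R 0 0) (entry_1 R 0 1)
  (entry_1 R 1 0) (entry_1 R 1 1)) /=.
by rewrite /alice_prob; case: ifP => _; case: (m _); rewrite ?expr0 ?expr1 /=; field.
Qed.

Section Statistics.
Context (R : realType) (theta : R).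
Hypothesis cos2E : cos theta ^+ 2 = (Num.sqrt 5)^-1.
Context (c0 c1 : R).

Lemma born_bobE (j : 'Z_5) (m : outcomes bool [set j; j + 1]) :
  born_local (ptraceA (ketbra (psi c0 c1))) (bob_obs theta) [set j; j + 1] m =
  bob_prob theta c0 c1 j (m (ctx_fst j (j + 1))) (m (ctx_snd j (j + 1))).
Proof.
rewrite /born_local born_ptraceA.
have [e1 e2 e3 e4] := joint_proj_bob_entries cos2E m.
rewrite (born_psi_real c0 c1 (entry_1 R 0 0) (entry_1 R 0 1) (entry_1 R 1 0)
  (entry_1 R 1 1) e1 e2 e3 e4) /=.
by rewrite /bob_prob; ring.
Qed.

Lemma born_jointE (x : 'I_2) (j : 'Z_5) (a : outcomes bool [set x])
    (b : outcomes bool [set j; j + 1]) :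
  born_joint (ketbra (psi c0 c1)) (alice_obs R) (bob_obs theta)
    [set x] [set j; j + 1] a b =
  joint_prob theta c0 c1 x (a (ctx_one x)) j
    (b (ctx_fst j (j + 1))) (b (ctx_snd j (j + 1))).
Proof.
rewrite /born_joint joint_proj_aliceE.
have [e1 e2 e3 e4] := spectral_proj_alice R x (a (ctx_one x)).
have [f1 f2 f3 f4] := joint_proj_bob_entries cos2E b.
rewrite (born_psi_real c0 c1 e1 e2 e3 e4 f1 f2 f3 f4) /joint_prob.
by case: ifP => _; case: (a _); rewrite ?expr0 ?expr1 /=; field.
Qed.

End Statistics.

(** * Hidden-variable models *)

Lemma esum_fin (R : realType) (L : finType) (f : L -> R) :
  (forall l, 0 <= f l) ->
  (\esum_(l in [set: L]%classic) (f l)%:E = (\sum_l f l)%:E)%E.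
Proof.
move=> f0; rewrite esum_fset; last by move=> l _; rewrite lee_fin.
  rewrite (fsbigE (index_enum L)) ?index_enum_uniq //.
    by rewrite -sumEFin; apply: eq_bigl => l; exact: mem_set.
  by move=> l _; rewrite mem_index_enum.
exact: finite_finset.
Qed.

Lemma is_pmf_fin (R : realType) (L : finType) (q : L -> R) :
  is_pmf q <-> (forall l, 0 <= q l) /\ \sum_l q l = 1.
Proof.
split=> -[q0 q1]; split=> //; move: q1; rewrite esum_fin //.
  by move=> [].
by move=> ->.
Qed.

Lemma is_pmf_delta (R : realType) (L : finType) (x : L) :
  is_pmf (fun y => (y == x)%:R : R).
Proof.
apply/is_pmf_fin; split=> [y|]; first exact: ler0n.
by rewrite (bigD1 x) //= eqxx big1 ?addr0 // => y /negPf ->.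
Qed.

Lemma bool_pmf_bounds (R : realType) (q : bool -> R) :
  is_pmf q -> 0 <= q true <= 1 /\ q false = 1 - q true.
Proof.
move=> /is_pmf_fin[q0]; rewrite big_bool /= => q1.
have := q0 true; have := q0 false.
by split; [apply/andP; split; lra | lra].
Qed.

(* The cyclic sum is affine in each b j, so its maximum over the cube is
   attained at a vertex. *)
Lemma cyclic5_le2 (R : realType) (b : 'Z_5 -> R) :
  (forall j, 0 <= b j <= 1) -> \sum_j b j * (1 - b (j + 1)) <= 2.
Proof.
move=> b01.
have bE j : b j = nth 0 [:: b 0; b 1; b 2; b 3; b 4] j.
  by case: j => -[|[|[|[|[|//]]]]] lt5 /=; congr b; apply: val_inj.
have b1E j : b (j + 1) = nth 0 [:: b 1; b 2; b 3; b 4; b 0] j.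
  by case: j => -[|[|[|[|[|//]]]]] lt5 /=; congr b; apply: val_inj.
under eq_bigr => j _ do rewrite (bE j) (b1E j).
rewrite !big_ord_recl big_ord0 /=.
have aff (f : R -> R) : (forall y, f y = f 0 + y * (f 1 - f 0)) ->
    f 0 <= 2 -> f 1 <= 2 -> forall x, 0 <= x <= 1 -> f x <= 2.
  by move=> fE f0 f1 x /andP[x0 x1]; rewrite (fE x); nra.
move: (b 0) (b 1) (b 2) (b 3) (b 4) (b01 0) (b01 1) (b01 2) (b01 3) (b01 4).
move=> x0 x1 x2 x3 x4 h0 h1 h2 h3 h4.
move: x0 h0; apply: (aff) => [y||]; first by ring.
all: move: x1 h1; apply: (aff) => [y||]; first by ring.
all: move: x2 h2; apply: (aff) => [y||]; first by ring.
all: move: x3 h3; apply: (aff) => [y||]; first by ring.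
all: move: x4 h4; apply: (aff) => [y||]; first by ring.
(* At a vertex the sum counts the cyclic descents from 1 to 0; each needs an ascent as well, so five
   positions allow at most two. *)
all: lra.
Qed.

(** Over the four outcomes [proj_entry f d] sums to [d], so Alice's marginal is independent of Bob's
    context. *)
Lemma sum_joint_prob (R : realType) (theta c0 c1 : R) (x : 'I_2) a (j : 'Z_5) :
  \sum_y \sum_z joint_prob theta c0 c1 x a j y z = alice_prob c0 c1 x a.
Proof.
rewrite !big_bool /= /joint_prob /alice_prob /entry00 /entry01 /entry11 /proj_entry.
by case: ifP => _; case: a; rewrite ?expr0 ?expr1; field.
Qed.

(** * The local and GLHV models, and the contradiction with GNCHV *)

Section Experiment.
Context (R : realType) (theta : R).
Hypotheses (cos_gt0 : 0 < cos theta) (sin_gt0 : 0 < sin theta).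
Hypothesis cos2E : cos theta ^+ 2 = (Num.sqrt 5)^-1.
Context (c0 c1 : R).
Hypotheses (c0E : c0 = 1 / 4) (c1E : c1 = Num.sqrt (1 - c0 ^+ 2)).

Let rho := ketbra (psi c0 c1).
Let pAB := born_joint rho (alice_obs R) (bob_obs theta).

Let c02 : c0 ^+ 2 = 1 / 16. Proof. by rewrite c0E; field. Qed.
Let c12 : c1 ^+ 2 = 15 / 16.
Proof. by rewrite c1E sqr_sqrtr c02; lra. Qed.

Lemma alice_locally_noncontextual :
  locally_noncontextual alice_ctx (born_local (ptraceB rho) (alice_obs R)).
Proof.
(* Alice's contexts are singletons, so a trivial hidden variable with her Born probabilities as
   responses is enough. *)
exists (unit : choiceType), (fun=> 1), (fun x _ => alice_prob c0 c1 x); split.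
- by apply/is_pmf_fin; split=> [_|]; rewrite ?ler01 // big_const card_unit /= addr0.
- move=> x _; apply/is_pmf_fin; rewrite big_bool /= /alice_prob c02 c12.
  by split=> [a|]; case: ifP => _; try case: a; lra.
- move=> _ /imsetP[x _ ->] m; rewrite born_aliceE.
  have p0 a : 0 <= alice_prob c0 c1 x a.
    by rewrite /alice_prob c02 c12; case: ifP => _; try case: a; lra.
  under eq_esum => l _ do rewrite mul1r (big_ctx_one _ (@mulr1 _)) /=.
  by rewrite (@esum_fin _ unit) // big_const card_unit /= addr0.
Qed.

Lemma bob_locally_noncontextual :
  locally_noncontextual bob_ctx (born_local (ptraceA rho) (bob_obs theta)).
Proof.
exists ('I_5 : choiceType), (bob_weight theta c0 c1),
  (fun j l y => (y == bob_strategy l j)%:R); split.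
- apply/is_pmf_fin; split; last exact: (sum_bob_weight cos2E c0E c1E).
  exact: (bob_weight_ge0 cos2E c0E c1E).
- by move=> j l; exact: is_pmf_delta.
- move=> _ /imsetP[j _ ->] m; rewrite (born_bobE cos2E).
  rewrite -(bob_model cos2E c0E c1E) -esum_fin; last first.
    by move=> l; rewrite mulr_ge0 ?(bob_weight_ge0 cos2E c0E c1E) // -natrM ler0n.
  apply: eq_esum => l _; congr (_ * _)%:E; apply/esym.
  apply: (big_ctx_pair (@mulr1 _) (Z5_succ_neq j)); exact: mulrC.
Qed.

(* The hidden variable ranges over the outcome pairs (+,+), (-,+), (-,-) of
   (A_1, A_2); the pair (+,-) gets weight 0. *)
Definition bell_weight (l : 'I_3) : R := nth 0 [:: 1 / 16; 7 / 16; 1 / 2] l.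

Definition bell_alice (l : 'I_3) (x : 'I_2) : bool :=
  if x == 0 then l != 0 else l == 2.

(** With [g x a] the probability of A_x = a jointly with a fixed outcome of Bob, these are the joint
    weights of that outcome and the hidden value [l]. *)
Definition bell_block (g : 'I_2 -> bool -> R) (l : 'I_3) : R :=
  nth 0 [:: g 0 false; g 1 false - g 0 false; g 1 true] l.

(** The hypothesis is no-signalling to Bob. It enters for A_1 = -1, where the weights add up to
    [g 1 false - g 0 false + g 1 true]. *)
Lemma bell_block_model (g : 'I_2 -> bool -> R) x a :
  g 0 false + g 0 true = g 1 false + g 1 true ->
  \sum_l (a == bell_alice l x)%:R * bell_block g l = g x a.
Proof.
move=> e; rewrite !big_ord_recl big_ord0 /bell_block /bell_alice -!val_eqE /=.
have [-> | ->] : x = 0 \/ x = 1.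
  by case: x => -[|[|//]] ?; [left|right]; apply: val_inj.
all: by case: a => /=; lra.
Qed.

Lemma bell_model : GLHV alice_ctx bob_ctx tested_ctx pAB.
Proof.
pose blk (CB : {set 'Z_5}) (b : outcomes bool CB) x s :=
  pAB (CA := [set x]) [ffun=> s] b.
have blkE j (b : outcomes bool [set j; j + 1]) x s :
  blk _ b x s = joint_prob theta c0 c1 x s j
    (b (ctx_fst j (j + 1))) (b (ctx_snd j (j + 1))).
  by rewrite /blk /pAB (born_jointE cos2E) ffunE.
have w_gt0 l : 0 < bell_weight l.
  by rewrite /bell_weight; case: l => -[|[|[|//]]] ? /=; lra.
have blk_ge0 j (b : outcomes bool [set j; j + 1]) l : 0 <= bell_block (blk _ b) l.
  have z := @joint_prob_zx _ _ cos_gt0 sin_gt0 cos2E _ _ c0E c1E j.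
  have x := @joint_prob_x_ge0 _ _ cos_gt0 sin_gt0 cos2E _ _ c0E c1E.
  rewrite /bell_block !blkE; case: l => -[|[|[|//]]] ? //=.
  - by rewrite /joint_prob /= mulr_ge0 ?sqr_ge0 // (entry00_ge0 cos2E).
  - by rewrite subr_ge0.
(* Alice answers deterministically; Bob's response is the conditional distribution of his block
   outcome given [l], whence the division by the positive weight of [l]. *)
exists ('I_3 : choiceType), bell_weight,
  (fun CA l a => (a == [ffun k => bell_alice l (val k)])%:R),
  (fun CB l b => bell_block (blk CB b) l / bell_weight l); split.
- apply/is_pmf_fin; split=> [l|]; first exact: ltW.
  by rewrite !big_ord_recl big_ord0 /bell_weight /=; field.
- by move=> CA _ l; exact: is_pmf_delta.
- move=> _ /imsetP[j _ ->] l; apply/is_pmf_fin; split=> [b|].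
    by rewrite divr_ge0 // ltW.
  rewrite -mulr_suml; apply: (canLR (mulfK _)); first exact: lt0r_neq0.
  rewrite mul1r.
  under eq_bigr => b _.
    rewrite [bell_block _ _](_ : _ = bell_block (fun x s => joint_prob theta c0 c1
      x s j (b (ctx_fst j (j + 1))) (b (ctx_snd j (j + 1)))) l); last first.
      by rewrite /bell_block !blkE.
    over.
  rewrite (sum_outcomes_pair (fun y z => bell_block (fun x s =>
    joint_prob theta c0 c1 x s j y z) l) (Z5_succ_neq j)).
  (* [bell_block] is linear in [g], so summing over Bob's outcomes turns joint probabilities into
     Alice's marginals, whatever [j] is, and these give [bell_weight l]. *)
  transitivity (bell_block (alice_prob c0 c1) l).
    rewrite /bell_block -!(sum_joint_prob theta c0 c1 _ _ j).
    case: l => -[|[|[|//]]] ? //=.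
    by rewrite -sumrB; apply: eq_bigr => y _; rewrite -sumrB.
  rewrite /bell_block /bell_weight /alice_prob /= c02 c12.
  by case: l => -[|[|[|//]]] ? //=; lra.
- move=> _ _ /finset.setXP[/imsetP[x _ ->] /imsetP[j _ ->]] a b.
  transitivity (\esum_(l in [set: 'I_3]%classic)
     ((a (ctx_one x) == bell_alice l x)%:R * bell_block (blk _ b) l)%:E)%E.
    rewrite esum_fin => [|l]; last by rewrite mulr_ge0.
    rewrite bell_block_model; first by rewrite blkE /pAB (born_jointE cos2E).
    by rewrite !blkE !joint_prob_nosignal.
  apply: eq_esum => l _; congr (_%:E).
  have -> : (a == [ffun k => bell_alice l (val k)]) = (a (ctx_one x) == bell_alice l x).
    apply/eqP/eqP => [->|e]; first by rewrite ffunE.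
    by apply/ffunP => k; rewrite ffunE (ctx_oneP k) e.
  by rewrite mulrCA [bell_weight l * _]mulrC divfK // lt0r_neq0.
Qed.

Lemma no_global_model : ~ GNCHV tested_ctx pAB.
Proof.
move=> [L [q [rA [rB [[q0 q1] rA1 rB1 H]]]]].
(* [w] is the hidden weight of the event A_1 = +1, and [Y j p] its part in which B_j and B_(j+1)
   have the outcomes [p]. *)
pose w l := q l * rA 0 l false.
pose Y j (p : bool * bool) l := w l * (rB j l p.1 * rB (j + 1) l p.2).
have w0 l : 0 <= w l by rewrite mulr_ge0 //; case: (rA1 0 l).
have Y0 j p l : 0 <= Y j p l.
  by rewrite mulr_ge0 // mulr_ge0 //; [case: (rB1 j l)|case: (rB1 (j + 1) l)].
have YE j p : (\esum_(l in [set: L]%classic) (Y j p l)%:E =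
    (joint_prob theta c0 c1 0 false j p.1 p.2)%:E)%E.
  pose a : outcomes bool [set (0 : 'I_2)] := [ffun=> false].
  pose b : outcomes bool [set j; j + 1] :=
    [ffun k => if val k == j then p.1 else p.2].
  have b1 : b (ctx_fst j (j + 1)) = p.1 by rewrite ffunE /= eqxx.
  have b2 : b (ctx_snd j (j + 1)) = p.2.
    by rewrite ffunE /= eq_sym (negPf (Z5_succ_neq j)).
  have tst : ([set 0], [set j; j + 1]) \in tested_ctx.
    by apply/finset.setXP; split; apply/imsetP; [exists 0|exists j].
  have := H _ _ tst a b.
  rewrite /pAB (born_jointE cos2E) b1 b2 [a _]ffunE => ->.
  apply: eq_esum => l _; congr (_%:E); rewrite /Y /w -mulrA; congr (_ * (_ * _)).
    by rewrite (big_ctx_one _ (@mulr1 _)) ffunE.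
  rewrite (big_ctx_pair (@mulr1 _) (Z5_succ_neq j)) ?b1 ?b2 //; exact: mulrC.
(* The cyclic bound averaged over [w]. Twice the probability of A_1 = +1 is written as two copies of
   a sum of data for the context of B_0 and B_1, so that both sides become sums of [Y] over the
   hidden variable. *)
have le5 : ((\sum_(j : 'Z_5) joint_prob theta c0 c1 0 false j true false)%:E <=
    (\sum_(p : bool * bool) joint_prob theta c0 c1 0 false 0 p.1 p.2)%:E +
    (\sum_(p : bool * bool) joint_prob theta c0 c1 0 false 0 p.1 p.2)%:E)%E.
  rewrite -!sumEFin.
  under eq_bigr do rewrite -(YE _ (true, false)).
  under [X in (_ <= X + X)%E]eq_bigr do rewrite -YE.
  rewrite -!esum_sum; try by move=> *; rewrite lee_fin.
  rewrite -esumD; try by move=> *; apply: sume_ge0 => *; rewrite lee_fin.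
  apply: le_esum => l _; rewrite !sumEFin -EFinD lee_fin.
  have rB01 j := bool_pmf_bounds (rB1 j l).
  have -> : \sum_(p : bool * bool) Y 0 p l = w l.
    rewrite -(pair_big xpredT xpredT (fun x y => Y 0 (x, y) l)) /= !big_bool /= /Y /=.
    by rewrite (rB01 0).2 (rB01 (0 + 1)).2; ring.
  (* Applied for each [l] to the response probabilities of B_j = -1. *)
  have := cyclic5_le2 (fun j => (rB01 j).1).
  move=> /(ler_wpM2l (w0 l)); rewrite mulr_sumr mulr_natr mulr2n; apply: le_trans.
  by apply: ler_sum => j _; rewrite /Y /= (rB01 (j + 1)).2.
move: le5; rewrite -EFinD lee_fin.
rewrite -(pair_big xpredT xpredT
  (fun y z => joint_prob theta c0 c1 0 false 0 y z)) /= sum_joint_prob.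
rewrite /joint_prob /entry00 /proj_entry /alice_prob /= sumr_const card_ord c02.
(* With t = cos^2 theta, the inequality says 5 t <= 2 after cancelling c0^2, while t >= 0 and t^2 =
   1/5 give 5 t = sqrt 5. *)
have : (cos theta ^+ 2) ^+ 2 = 5^-1 by rewrite cos2E exprVn sqr_sqrtr.
have := sqr_ge0 (cos theta); move: (cos theta ^+ 2) => t t0 t2.
rewrite -[(Zp_trunc 5).+2]/5%N -mulr_natr => {q1 YE H} h; nra.
Qed.

End Experiment.

Theorem mainTheorem2 (R : realType) (theta : R)
    (cos_gt0 : 0 < cos theta) (sin_gt0 : 0 < sin theta)
    (cos2E : cos theta ^+ 2 = (Num.sqrt 5)^-1)
    (c0 : R) (c0E : c0 = 1 / 4) (c1 : R) (c1E : c1 = Num.sqrt (1 - c0 ^+ 2)) :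
  let rho := ketbra (psi c0 c1) in
  [/\ forall CA, CA \in alice_ctx -> compatible (alice_obs R) CA,
      forall CB, CB \in bob_ctx -> compatible (bob_obs theta) CB &
      globally_contextual alice_ctx bob_ctx tested_ctx
        (born_local (ptraceB rho) (alice_obs R))
        (born_local (ptraceA rho) (bob_obs theta))
        (born_joint rho (alice_obs R) (bob_obs theta))].
Proof.
split.
- by move=> _ /imsetP[x _ ->] y z /set1P-> /set1P->.
- move=> _ /imsetP[j _ ->] y z; have e := bob_obs_comm cos2E j.
  move=> /set2P[]-> /set2P[]->;
    [reflexivity|exact: e|exact: esym e|reflexivity].
split; last exact: no_global_model.
  split; first exact: (alice_locally_noncontextual c0E c1E).
  exact: (bob_locally_noncontextual cos2E c0E c1E).
exact: (bell_model cos_gt0 sin_gt0 cos2E c0E c1E).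
Qed.
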